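(* Let $T$ be a rooted tree, let $\alpha,\sigma:T\to[0,\infty)$ be weights with $\sigma$ non-increasing, and let $X_t=\sigma(t)\sum_{v\preceq t}\alpha(v)\xi_v$, $t\in T$. Let $d_X$ be the Dudley metric of $X$ and $d$ the metric generated by $\alpha$ and $\sigma$ (both defined in the context). Then $$\int_0^\infty\sqrt{\log N(T,d_X,u)}\,du<\infty\quad\Longleftrightarrow\quad\int_0^\infty\sqrt{\log N(T,d,u)}\,du<\infty$$ and $$\sup_{\varepsilon>0}\varepsilon^2\log N(T,d_X,\varepsilon)<\infty\quad\Longleftrightarrow\quad\sup_{\varepsilon>0}\varepsilon^2\log N(T,d,\varepsilon)<\infty.$$
   Context: $T$ is a finite or infinite tree with a unique root $\mathbf 0$, each element having a finite number (possibly zero) of offspring. $t\preceq s$ means that $t$ lies on the branch connecting $\mathbf 0$ with $s$ (including $t=s$); $t\prec s$ means $t\preceq s$, $t\ne s$; $t\wedge s$ is the infimum of $t,s$. $\sigma$ non-increasing means $\sigma(t)\ge\sigma(s)$ whenever $t\preceq s$. $(\xi_v)_{v\in T}$ are i.i.d. standard normal random variables. $d_X(t,s):=(\mathbb E|X_t-X_s|^2)^{1/2}$. For $t\preceq s$, $$d(t,s)=d(s,t):=\max_{t\prec r\preceq s}\sigma(r)\Big(\sum_{t\prec v\preceq r}\alpha(v)^2\Big)^{1/2}$$ (with $d(t,t)=0$), and $d(t,s):=d(t\wedge s,t)+d(t\wedge s,s)$ if $t,s$ are not comparable. For $\rho\in\{d,d_X\}$, $N(T,\rho,\varepsilon)$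 is the minimal number of open $\rho$-balls of radius $\varepsilon$ with centers in $T$ needed to cover $T$ ($+\infty$ if there is no finite cover). *)

(* Defs.v *)
From HB Require Import structures.
From mathcomp Require Import all_boot all_order all_algebra.
From mathcomp Require Import all_classical all_reals all_analysis.

Set Implicit Arguments.
Unset Strict Implicit.
Unset Printing Implicit Defensive.

Import Order.TTheory GRing.Theory Num.Theory.
Import numFieldNormedType.Exports.

Local Open Scope classical_set_scope.
Local Open Scope ring_scope.

(* A rooted tree is given by its parent map. The root has no parent; by
   convention it is mapped to itself. [root_reached] makes every vertex
   descend from the root, at finite depth, and excludes cycles. *)
Record rootedTree := RootedTree {
  vertex :> choiceType;
  root : vertex;
  parent : vertex -> vertex;
  parent_root : parent root = root;
  root_reached : forall t, exists n, iter n parent t == root;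
  finite_offspring :
    forall t, finite_set [set s | s != root /\ parent s = t] }.

Arguments root {r}.
Arguments parent {r}.

Section order.
Context {T : rootedTree}.
Implicit Types r s t v : T.

Definition depth t : nat := ex_minn (root_reached t).

(* the vertices t, parent t, ..., root, each listed once *)
Definition branch t : seq T := traject parent t (depth t).+1.

Definition tree_le t s : bool := t \in branch s.
Definition tree_lt t s : bool := (t != s) && tree_le t s.

Definition is_tree_inf t s r : Prop :=
  [/\ tree_le r t, tree_le r s &
      forall q, tree_le q t -> tree_le q s -> tree_le q r].

Definition tree_inf t s : T := xget root [set r | is_tree_inf t s r].

Lemma iter_parent_root n : iter n parent root = root :> T.
Proof. by elim: n => //= n ->; exact: parent_root. Qed.

Lemma tree_leP t s :
  reflect (exists n, t = iter n parent s) (tree_le t s).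
Proof.
apply: (iffP trajectP) => [[n _ ->]|[n ->]]; first by exists n.
have [ltn|lten] := ltnP n (depth s).+1; first by exists n.
exists (depth s) => //; rewrite -(subnK (ltnW lten)) iterD.
by rewrite /depth; case: ex_minnP => m /eqP -> _; exact: iter_parent_root.
Qed.

Lemma tree_infP t s : is_tree_inf t s (tree_inf t s).
Proof.
rewrite /tree_inf; suff : exists r, is_tree_inf t s r.
  by case=> r rts; case: xgetP => [_ ->//|/(_ r)].
have [n /eqP tn] := root_reached t.
have : exists k, tree_le (iter k parent t) s.
  exists n; rewrite tn; have [m /eqP sm] := root_reached s.
  by apply/tree_leP; exists m.
move/ex_minnP => [k kts kmin]; exists (iter k parent t).
split=> // [|q /tree_leP[m ->] /kmin km]; first by apply/tree_leP; exists k.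
by apply/tree_leP; exists (m - k)%N; rewrite -iterD subnK.
Qed.

End order.

Section distance.
Context {R : realType} {T : rootedTree} (alpha sigma : T -> R).

(* the maximum over t \prec r \preceq s, for t \preceq s; all the terms are
   nonnegative, and the value is 0 when t = s *)
Definition branch_dist (t s : T) : R :=
  \big[Num.max/0]_(r <- branch s | tree_lt t r)
    (sigma r * Num.sqrt (\sum_(v <- branch r | tree_lt t v) alpha v ^+ 2)).

Definition tree_dist (t s : T) : R :=
  if tree_le t s then branch_dist t s
  else if tree_le s t then branch_dist s t
  else branch_dist (tree_inf t s) t + branch_dist (tree_inf t s) s.

End distance.

Section process.
Context {d : measure_display} {Omega : measurableType d} {R : realType}
  (P : probability Omega R).

Definition mutually_independent (I : choiceType) (xi : I -> {RV P >-> R}) :=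
  forall (s : seq I) (B : I -> set R), uniq s ->
    (forall i, measurable (B i)) ->
    P (\bigcap_(i in [set` s]) (xi i @^-1` B i)) =
    (\prod_(i <- s) P (xi i @^-1` B i))%E.

Definition standard_normal (X : {RV P >-> R}) :=
  forall A : set R, measurable A -> distribution P X A = normal_prob 0 1 A.

Definition weighted_sum (T : rootedTree) (alpha sigma : T -> R)
    (xi : T -> {RV P >-> R}) (t : T) : Omega -> R :=
  fun w => sigma t * \sum_(v <- branch t) alpha v * xi v w.

Definition dudley_dist (T : Type) (X : T -> Omega -> R) (t s : T) : R :=
  Num.sqrt (fine 'E_P[fun w => `|X t w - X s w| ^+ 2]).

End process.

Section entropy.
Context {R : realType} {T : choiceType} (rho : T -> T -> R).

Definition ball_cover (eps : R) (c : seq T) : Prop :=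
  forall t, exists2 s, s \in c & rho s t < eps.

(* ereal_inf set0 = +oo: this is +oo when there is no finite cover *)
Definition covering_number (eps : R) : \bar R :=
  ereal_inf [set (size c)%:R%:E | c in [set c | ball_cover eps c]].

Definition entropy_integral : \bar R :=
  (\int[lebesgue_measure]_(u in `]0%R, +oo[) sqrte (lne (covering_number u)))%E.

Definition entropy_sup : \bar R :=
  ereal_sup [set ((eps ^+ 2)%:E * lne (covering_number eps))%E
            | eps in `]0, +oo[].

End entropy.

(* Main.v *)
Require Import Defs.
From HB Require Import structures.
From mathcomp Require Import all_boot all_order all_algebra.
From mathcomp Require Import all_classical all_reals all_analysis.
From mathcomp Require Import measurable_realfun ring lra.
Set Implicit Arguments.
Unset Strict Implicit.
Unset Printing Implicit Defensive.
Import Order.TTheory GRing.Theory Num.Theory.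
Import numFieldNormedType.Exports.
Local Open Scope classical_set_scope.
Local Open Scope ring_scope.

(** Write [A t] ([branch_weight]) for the sum of [alpha v ^ 2] over the branch
    of [t], and [Q u r = sigma r ^ 2 * (A r - A u)] ([excess]). With [w] the infimum of [t] and [s],
    orthonormality of the [xi v] gives
    [d_X t s ^ 2 = (sigma t - sigma s) ^ 2 * A w + Q w t + Q w s], while
    [d t s] is comparable to the square root of the maximum of [Q w r] over
    [r] between [w] and [t] or [w] and [s]. The metrics are not comparable, but
    their covering numbers are, up to a factor polynomial in the inverse radius.

    From [d_X] to [d]: walking up each branch, mark the root and every [r] with
    [Q m r >= (2 e) ^ 2], [m] being the last mark before [r]. Every vertex is
    [d]-close to its last mark, and two marks in the same [d_X]-ball of radius
    [e] are [d]-close, so one mark per ball suffices and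
    [N (d, 6 e) <= N (d_X, e)].

    From [d] to [d_X]: the extra term [(sigma t - sigma s) ^ 2 * A w] is
    controlled by subdividing each [d]-ball according to the integer part of
    [sigma t * sqrt (A t) / e]. As [sigma t * sqrt (A t)] is bounded by some [M],
    [N (d_X, 4 e) <= N (d, e) * (1 + floor (M / e))]; the last factor is [1] for
    [e > M] and its logarithm contributes finitely to both functionals. *)

(* [Defs.root] is shadowed by the roots of polynomials. *)
Local Notation root := Defs.root.

Section tree_order.
Context {T : rootedTree}.
Implicit Types r s t u v : T.

Lemma tree_le_refl t : tree_le t t.
Proof. by apply/tree_leP; exists 0%N. Qed.

Lemma tree_le_trans s r t : tree_le r s -> tree_le s t -> tree_le r t.
Proof.
by move=> /tree_leP[m ->] /tree_leP[n ->]; apply/tree_leP; exists (m + n)%N; rewrite iterD.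
Qed.

Lemma tree_le_total t r s : tree_le r t -> tree_le s t ->
  tree_le r s || tree_le s r.
Proof.
move=> /tree_leP[m ->] /tree_leP[n ->]; apply/orP.
have [mn|/ltnW nm] := leqP m n; [right|left]; apply/tree_leP.
  by exists (n - m)%N; rewrite -iterD subnK.
by exists (m - n)%N; rewrite -iterD subnK.
Qed.

Lemma iter_depth t : iter (depth t) parent t = root.
Proof. by rewrite /depth; case: ex_minnP => m /eqP. Qed.

Lemma depth_min n t : iter n parent t = root -> (depth t <= n)%N.
Proof. by rewrite /depth; case: ex_minnP => m _ + tn; apply; rewrite tn. Qed.

Lemma depth_parent t : t != root -> depth t = (depth (parent t)).+1.
Proof.
move=> tr; apply/eqP; rewrite eqn_leq; apply/andP; split.
  by apply: depth_min; rewrite iterSr iter_depth.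
case E : (depth t) (iter_depth t) => [|n]; first by move=> /= t0; rewrite t0 eqxx in tr.
by rewrite iterSr => /depth_min.
Qed.

Lemma tree_le_depth s t : tree_le s t -> (depth s <= depth t)%N.
Proof.
move=> /tree_leP[n ->]; elim: n => //= n IH.
have [->|/depth_parent E] := eqVneq (iter n parent t) root.
  by rewrite parent_root; apply: depth_min; exact: iter_parent_root.
by rewrite (leq_trans _ IH)// E.
Qed.

Lemma tree_le_parent t : tree_le (parent t) t.
Proof. by apply/tree_leP; exists 1%N. Qed.

Lemma tree_lt_parent s t : tree_lt s t -> (t != root) && tree_le s (parent t).
Proof.
move=> /andP[+ /tree_leP[[|n] st]]; first by rewrite st eqxx.
move=> snt; apply/andP; split; last by apply/tree_leP; exists n; rewrite st iterSr.
by apply: contra_neq snt => t0; rewrite st t0 iter_parent_root.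
Qed.

Lemma tree_lt_depth s t : tree_lt s t -> (depth s < depth t)%N.
Proof.
by move=> /tree_lt_parent/andP[/depth_parent -> /tree_le_depth].
Qed.

Lemma tree_le_anti s t : tree_le s t -> tree_le t s -> s = t.
Proof.
move=> st /tree_le_depth; rewrite leqNgt; apply: contraNeq => nst.
by apply: tree_lt_depth; rewrite /tree_lt nst.
Qed.

Lemma tree_ltW s t : tree_lt s t -> tree_le s t.
Proof. by case/andP. Qed.

Lemma tree_ltNge u r t : tree_le u t -> tree_le r t ->
  tree_lt u r = ~~ tree_le r u.
Proof.
move=> ut rt; apply/idP/idP => [/tree_lt_depth|nru].
  by rewrite ltnNge; apply: contra => /tree_le_depth.
have := tree_le_total ut rt; rewrite (negbTE nru) orbF /tree_lt => ->.
by rewrite andbT; apply: contraNneq nru => ->; exact: tree_le_refl.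
Qed.

Lemma tree_le_eqVlt s t : tree_le s t = (s == t) || tree_lt s t.
Proof.
by rewrite /tree_lt; have [->|] := eqVneq s t; rewrite ?tree_le_refl.
Qed.

Lemma branch_uniq t : uniq (branch t).
Proof.
have [n] := ubnP (depth t); elim: n t => // n IH t tn.
have [->|tr] := eqVneq t root.
  by rewrite /branch (_ : depth root = 0%N)//; apply/eqP; rewrite -leqn0 depth_min.
rewrite /branch (depth_parent tr) trajectS cons_uniq -/(branch (parent t)) -/(tree_le _ _).
rewrite IH ?andbT; last by rewrite -ltnS -(depth_parent tr).
by apply/negP => /tree_le_depth; rewrite (depth_parent tr) ltnn.
Qed.

Lemma tree_inf_lel t s : tree_le (tree_inf t s) t.
Proof. by have [] := tree_infP t s. Qed.

Lemma tree_inf_ler t s : tree_le (tree_inf t s) s.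
Proof. by have [] := tree_infP t s. Qed.

Lemma tree_inf_max t s u : tree_le u t -> tree_le u s -> tree_le u (tree_inf t s).
Proof. by have [_ _] := tree_infP t s; apply. Qed.

Lemma tree_infC t s : tree_inf t s = tree_inf s t.
Proof.
by apply: tree_le_anti; apply: tree_inf_max;
  rewrite ?tree_inf_lel ?tree_inf_ler.
Qed.

Lemma tree_inf_l t s : tree_le t s -> tree_inf t s = t.
Proof.
move=> ts; apply: tree_le_anti (tree_inf_lel _ _) _.
by apply: tree_inf_max => //; exact: tree_le_refl.
Qed.

Lemma sum_branch_split (V : nmodType) (F : T -> V) u t : tree_le u t ->
  \sum_(v <- branch t) F v =
  \sum_(v <- branch u) F v + \sum_(v <- branch t | tree_lt u v) F v.
Proof.
move=> ut; rewrite (bigID (tree_le^~ u))/=; congr (_ + _).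
  rewrite -big_filter; apply: perm_big; apply: uniq_perm.
  - by rewrite filter_uniq// branch_uniq.
  - exact: branch_uniq.
  - move=> v; rewrite mem_filter -/(tree_le v t) -/(tree_le v u) andb_idr//.
    by move=> vu; exact: tree_le_trans vu ut.
rewrite big_seq_cond [RHS]big_seq_cond; apply: eq_bigl => v.
by apply: andb_id2l => vt; rewrite (tree_ltNge ut).
Qed.

End tree_order.

Section weights.
Context {R : realType} {T : rootedTree} (alpha sigma : T -> R).
Implicit Types r s t u v w x : T.

Definition branch_weight t : R := \sum_(v <- branch t) alpha v ^+ 2.

Definition excess u r : R := sigma r ^+ 2 * (branch_weight r - branch_weight u).

Definition sum_dist t s : R := let w := tree_inf t s in
  Num.sqrt ((sigma t - sigma s) ^+ 2 * branch_weight w +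
            excess w t + excess w s).

Local Notation A := branch_weight.
Local Notation Q := excess.

Lemma branch_weight_ge0 t : 0 <= A t.
Proof. by apply: sumr_ge0 => v _; exact: sqr_ge0. Qed.

Lemma branch_weightB u t : tree_le u t ->
  A t - A u = \sum_(v <- branch t | tree_lt u v) alpha v ^+ 2.
Proof. by move=> ut; rewrite /A (sum_branch_split _ ut) addrC addKr. Qed.

Lemma le_branch_weight u t : tree_le u t -> A u <= A t.
Proof.
move=> ut; rewrite -subr_ge0 branch_weightB//.
by apply: sumr_ge0 => v _; exact: sqr_ge0.
Qed.

Lemma excess_tt t : Q t t = 0.
Proof. by rewrite /Q subrr mulr0. Qed.

Lemma excess_ge0 u t : tree_le u t -> 0 <= Q u t.
Proof. by move=> ut; rewrite mulr_ge0 ?sqr_ge0// subr_ge0 le_branch_weight. Qed.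

Lemma le_excess u w t : tree_le u w -> Q w t <= Q u t.
Proof. by move=> uw; rewrite ler_wpM2l ?sqr_ge0// lerB// le_branch_weight. Qed.

Hypothesis sigma_ge0 : forall t, 0 <= sigma t.
Hypothesis sigma_nincr : forall t s, tree_le t s -> sigma s <= sigma t.

Lemma excess_trans u r t : tree_le u r -> tree_le r t -> Q u t <= Q u r + Q r t.
Proof.
move=> ur rt; have sq : sigma t ^+ 2 <= sigma r ^+ 2.
  by rewrite lerXn2r ?nnegrE// sigma_nincr.
rewrite /Q; have := le_branch_weight ur; have := le_branch_weight rt.
nra.
Qed.

Lemma branch_dist_ltP u t (e : R) : 0 < e -> tree_le u t ->
  branch_dist alpha sigma u t < e <->
  (forall r, tree_le u r -> tree_le r t -> Q u r < e ^+ 2).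
Proof.
move=> e0 ut.
have term r : tree_le u r -> (sigma r * Num.sqrt (\sum_(v <- branch r | tree_lt u v)
    alpha v ^+ 2) < e) = (Q u r < e ^+ 2).
  move=> ur; rewrite -branch_weightB// /Q.
  rewrite -(@ltr_pXn2r _ 2) ?nnegrE ?(ltW e0) ?mulr_ge0 ?sqrtr_ge0//.
  by rewrite exprMn sqr_sqrtr// subr_ge0 le_branch_weight.
rewrite /branch_dist; split => [H r ur rt|H].
  have [->|nur] := eqVneq u r; first by rewrite excess_tt exprn_gt0.
  rewrite -term//; apply: le_lt_trans H.
  by apply: (le_bigmax_seq _ r) => //; rewrite /tree_lt nur.
rewrite big_seq_cond; apply: bigmax_lt => // r /andP[rt /tree_ltW ur].
by rewrite term// H.
Qed.

Lemma le_branch_dist u w t : tree_le u w -> tree_le w t ->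
  branch_dist alpha sigma w t <= branch_dist alpha sigma u t.
Proof.
move=> uw wt; rewrite leNgt; apply/negP.
set e := branch_dist _ _ w t => ue; have ut := tree_le_trans uw wt.
have e0 : 0 < e.
  by apply: le_lt_trans ue; rewrite /branch_dist; exact: bigmax_ge_id.
suff : e < e by rewrite ltxx.
apply/(branch_dist_ltP e0 wt) => r wr rt.
apply: le_lt_trans (le_excess _ uw) _.
exact: ((branch_dist_ltP e0 ut).1 ue r (tree_le_trans uw wr) rt).
Qed.

Lemma tree_dist_lt u t s a b : 0 < a -> 0 < b -> tree_le u t -> tree_le u s ->
  branch_dist alpha sigma u t < a -> branch_dist alpha sigma u s < b ->
  tree_dist alpha sigma t s < a + b.
Proof.
move=> a0 b0 ut us uta usb; rewrite /tree_dist.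
case: ifPn => [ts|_].
  have := le_branch_dist ut ts; lra.
case: ifPn => [st|_].
  have := le_branch_dist us st; lra.
have uw := tree_inf_max ut us.
have := le_branch_dist uw (tree_inf_lel t s).
have := le_branch_dist uw (tree_inf_ler t s).
lra.
Qed.

Lemma branch_dist_ge0 u t : 0 <= branch_dist alpha sigma u t.
Proof. exact: bigmax_ge_id. Qed.

Lemma tree_dist_lt_inf t s e : 0 < e -> tree_dist alpha sigma t s < e ->
  branch_dist alpha sigma (tree_inf t s) t < e /\
  branch_dist alpha sigma (tree_inf t s) s < e.
Proof.
have D0 t' : branch_dist alpha sigma t' t' = 0.
  apply/eqP; rewrite eq_le branch_dist_ge0 andbT leNgt; apply/negP.
  set a := branch_dist _ _ _ _ => a0; suff : a < a by rewrite ltxx.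
  apply/branch_dist_ltP => //; first exact: tree_le_refl.
  by move=> r /tree_le_anti/[apply] <-; rewrite excess_tt exprn_gt0.
move=> e0; rewrite /tree_dist.
case: ifPn => [ts|_]; first by rewrite (tree_inf_l ts) D0.
case: ifPn => [st|_]; first by rewrite tree_infC (tree_inf_l st) D0.
have := branch_dist_ge0 (tree_inf t s) t; have := branch_dist_ge0 (tree_inf t s) s.
by move=> *; split; lra.
Qed.

Lemma sum_dist_lt t s e : 0 < e ->
  (sum_dist t s < e) = ((sigma t - sigma s) ^+ 2 * A (tree_inf t s) +
    Q (tree_inf t s) t + Q (tree_inf t s) s < e ^+ 2).
Proof.
move=> e0; rewrite /sum_dist -(@ltr_pXn2r _ 2) ?nnegrE ?sqrtr_ge0 ?ltW//.
by rewrite sqr_sqrtr// !addr_ge0 ?excess_ge0 ?tree_inf_lel ?tree_inf_ler//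
  mulr_ge0 ?sqr_ge0 ?branch_weight_ge0.
Qed.

Lemma sum_dist_excess x t s e : 0 < e -> sum_dist x t < e -> sum_dist x s < e ->
  Q (tree_inf t s) t < (2 * e) ^+ 2.
Proof.
move=> e0; rewrite !sum_dist_lt//.
set u := tree_inf x t; set u' := tree_inf x s; set w := tree_inf t s => ht hs.
have ux : tree_le u x := tree_inf_lel _ _; have ut : tree_le u t := tree_inf_ler _ _.
have u'x : tree_le u' x := tree_inf_lel _ _; have u's : tree_le u' s := tree_inf_ler _ _.
have := excess_ge0 ux; have := excess_ge0 ut.
have := excess_ge0 u'x; have := excess_ge0 u's.
have := branch_weight_ge0 u; have := branch_weight_ge0 u'.
have [uu'|] := orP (tree_le_total ux u'x).
  have /(le_excess t) : tree_le u w by rewrite tree_inf_max// (tree_le_trans uu').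
  have := mulr_ge0 (sqr_ge0 (sigma x - sigma t)) (branch_weight_ge0 u).
  move=> *; nra.
move=> u'u.
have /(le_excess t) : tree_le u' w by rewrite tree_inf_max// (tree_le_trans u'u).
have := mulr_ge0 (sqr_ge0 (sigma x - sigma s)) (branch_weight_ge0 u').
have := le_branch_weight u'u; have := le_branch_weight ux.
move: ht hs; rewrite /Q; set a := sigma x; set b := sigma t.
move=> ht hs h1 h2 h3 h4 h5 h6 h7 h8 h9 h10.
apply: le_lt_trans h4 _.
have k1 : b ^+ 2 * (A u - A u') <= 2 * a ^+ 2 * (A u - A u') + 2 * (a - b) ^+ 2 * (A u - A u').
  rewrite -mulrDl ler_wpM2r ?subr_ge0//; have := sqr_ge0 (2 * a - b); nra.
have k2 : a ^+ 2 * (A u - A u') <= a ^+ 2 * (A x - A u').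
  by rewrite ler_wpM2l ?sqr_ge0// lerD2r.
have k3 : (a - b) ^+ 2 * (A u - A u') <= (a - b) ^+ 2 * A u.
  by rewrite ler_wpM2l ?sqr_ge0// gerBl.
nra.
Qed.

End weights.

Section covers.
Context {R : realType} {T : rootedTree} (alpha sigma : T -> R).
Implicit Types r s t u v w x : T.

Local Notation A := (branch_weight alpha).
Local Notation Q := (excess alpha sigma).
Local Notation D := (branch_dist alpha sigma).

Lemma rooted_tree_ind (P : T -> Prop) : P root ->
  (forall t, t != root -> P (parent t) -> P t) -> forall t, P t.
Proof.
move=> P0 PS t; have [n] := ubnP (depth t); elim: n t => // n IH t tn.
have [->//|tr] := eqVneq t root; apply: PS => //; apply: IH.
by rewrite -ltnS -(depth_parent tr).
Qed.

Fixpoint last_mark_rec (e : R) n t : T :=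
  if n is n'.+1 then
    let m := last_mark_rec e n' (parent t) in if e ^+ 2 <= Q m t then t else m
  else root.

Definition last_mark e t := last_mark_rec e (depth t) t.

Lemma last_mark_root e : last_mark e root = root.
Proof.
by rewrite /last_mark (_ : depth root = 0%N)//; apply/eqP; rewrite -leqn0 depth_min.
Qed.

Lemma last_markE e t : t != root -> last_mark e t =
  if e ^+ 2 <= Q (last_mark e (parent t)) t then t else last_mark e (parent t).
Proof. by move=> tr; rewrite {1}/last_mark (depth_parent tr). Qed.

Lemma last_mark_le e t : tree_le (last_mark e t) t.
Proof.
elim/rooted_tree_ind: t => [|t tr IH]; first by rewrite last_mark_root tree_le_refl.
rewrite last_markE//; case: ifP => _; first exact: tree_le_refl.
exact: tree_le_trans IH (tree_le_parent t).
Qed.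

Lemma last_mark_idem e t : last_mark e (last_mark e t) = last_mark e t.
Proof.
elim/rooted_tree_ind: t => [|t tr IH]; first by rewrite !last_mark_root.
by rewrite (last_markE _ tr); case: ifPn => // H; rewrite last_markE// H.
Qed.

Lemma last_mark_excess e t r : 0 < e -> tree_le (last_mark e t) r ->
  tree_le r t -> Q (last_mark e t) r < e ^+ 2.
Proof.
move=> e0; elim/rooted_tree_ind: t r => [|t tr IH] r.
  rewrite last_mark_root => r0 /(tree_le_anti r0) <-.
  by rewrite excess_tt exprn_gt0.
rewrite last_markE//; case: ifPn => [_ tr' /(tree_le_anti tr') <-|].
  by rewrite excess_tt exprn_gt0.
rewrite -ltNge => tm mr; rewrite tree_le_eqVlt => /predU1P[->//|].
by move=> /tree_lt_parent/andP[_]; exact: IH.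
Qed.

Hypothesis sigma_ge0 : forall t, 0 <= sigma t.
Hypothesis sigma_nincr : forall t s, tree_le t s -> sigma s <= sigma t.

(* The last mark [m] before [r] has [Q m r >= e ^+ 2 > Q w r], so it precedes
   [w], and [Q w q <= Q m q < e ^+ 2] for [q] strictly between [w] and [r]. *)
Lemma mark_branch_dist e w r : 0 < e -> last_mark e r = r -> tree_le w r ->
  Q w r < e ^+ 2 -> D w r < e.
Proof.
move=> e0 rr wr wre; apply/branch_dist_ltP => // q wq.
rewrite tree_le_eqVlt => /predU1P[->//|/tree_lt_parent/andP[r0 qp]].
have mp := last_mark_le e (parent r); set m := last_mark _ _ in mp.
have pr := tree_le_parent r.
have mr : e ^+ 2 <= Q m r.
  rewrite leNgt; apply/negP => mr; move: rr; rewrite last_markE// -/m leNgt mr/=.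
  by move=> mr'; move: (tree_le_depth mp); rewrite mr' (depth_parent r0) ltnn.
have mw : tree_le m w.
  have /orP[//|wm] := tree_le_total (tree_le_trans mp pr) wr.
  by have := le_lt_trans (le_excess alpha sigma r wm) wre; rewrite ltNge mr.
apply: le_lt_trans (le_excess _ _ _ mw) _.
by apply: last_mark_excess => //; exact: tree_le_trans wq.
Qed.

Lemma ball_cover_tree_dist e c : 0 < e -> ball_cover (sum_dist alpha sigma) e c ->
  exists2 c', ball_cover (tree_dist alpha sigma) (6 * e) c' & size c' = size c.
Proof.
move=> e0 cov; set L := last_mark (2 * e).
have e20 : 0 < 2 * e by lra.
pose f x := xget root [set r | L r = r /\ sum_dist alpha sigma x r < e].
exists (map f c); last by rewrite size_map.
move=> s; have [x xc xLs] := cov (L s).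
exists (f x); first exact: map_f.
have [ff fx] : L (f x) = f x /\ sum_dist alpha sigma x (f x) < e.
  rewrite /f; case: xgetP => [_ -> //|/(_ (L s))]; elim.
  by split => //; exact: last_mark_idem.
move: (f x) ff fx => {f} r rr xr.
set w := tree_inf r (L s).
have wr : tree_le w r := tree_inf_lel _ _; have wL : tree_le w (L s) := tree_inf_ler _ _.
have Ls : tree_le (L s) s := last_mark_le _ _.
have Qr : Q w r < (2 * e) ^+ 2 by exact: sum_dist_excess xr xLs.
have QL : Q w (L s) < (2 * e) ^+ 2.
  by rewrite /w tree_infC; exact: sum_dist_excess xLs xr.
have DL : D w (L s) < 2 * e by apply: mark_branch_dist => //; exact: last_mark_idem.
rewrite (_ : 6 * e = 2 * e + 4 * e); last by ring.
apply: (@tree_dist_lt _ _ _ _ sigma_ge0 w) => //.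
- lra.
- exact: tree_le_trans wL Ls.
- exact: mark_branch_dist.
apply/branch_dist_ltP => //; [lra|exact: tree_le_trans wL Ls|].
move=> q wq qs; have [qL|] := orP (tree_le_total qs Ls).
  have := (branch_dist_ltP alpha sigma_ge0 e20 wL).1 DL q wq qL; nra.
move=> Lq; apply: le_lt_trans (excess_trans alpha sigma_ge0 sigma_nincr wL Lq) _.
have := last_mark_excess e20 Lq qs; nra.
Qed.

Lemma sqrt_branch_weightB u t : tree_le u t ->
  sigma t * Num.sqrt (A t) <= sigma t * Num.sqrt (A u) + Num.sqrt (Q u t).
Proof.
move=> ut; rewrite /excess sqrtrM ?sqr_ge0// sqrtr_sqr ger0_norm// -mulrDr.
rewrite ler_wpM2l//; have Au := branch_weight_ge0 alpha u.
have : 0 <= A t - A u by rewrite subr_ge0 le_branch_weight.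
set B := A t - A u => B0; rewrite (_ : A t = A u + B); last by rewrite /B; ring.
rewrite -(@ler_pXn2r _ 2) ?nnegrE ?addr_ge0 ?sqrtr_ge0//.
rewrite sqrrD !sqr_sqrtr// ?(addr_ge0 Au)// addrAC lerDl.
by rewrite mulrn_wge0// mulr_ge0 ?sqrtr_ge0.
Qed.

Lemma sqrt_branch_weight_bounded e c : 0 < e ->
  ball_cover (tree_dist alpha sigma) e c ->
  exists2 M, 0 <= M & forall t, sigma t * Num.sqrt (A t) <= M.
Proof.
move=> e0 cov.
have F0 u : 0 <= sigma u * Num.sqrt (A u) by rewrite mulr_ge0 ?sqrtr_ge0.
have S0 x : 0 <= \sum_(u <- branch x) sigma u * Num.sqrt (A u) by exact: sumr_ge0.
exists (e + \sum_(x <- c) \sum_(u <- branch x) sigma u * Num.sqrt (A u)).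
  by apply: addr_ge0; [exact: ltW|exact: sumr_ge0].
move=> t; have [x xc /(tree_dist_lt_inf sigma_ge0 e0)[Dx Dt]] := cov t.
have ux := tree_inf_lel x t; have ut := tree_inf_ler x t.
set u := tree_inf x t in Dx Dt ux ut.
apply: le_trans (sqrt_branch_weightB ut) _; rewrite addrC lerD//.
  rewrite -(ger0_norm (ltW e0)) -sqrtr_sqr ler_wsqrtr// ltW//.
  exact: ((branch_dist_ltP alpha sigma_ge0 e0 ut).1 Dt t ut (tree_le_refl t)).
apply: (@le_trans _ _ (sigma u * Num.sqrt (A u))).
  by rewrite ler_wpM2r ?sqrtr_ge0// sigma_nincr.
rewrite (big_rem x xc)/= (big_rem u ux)/= -addrA lerDl addr_ge0//; exact: sumr_ge0.
Qed.

Lemma ball_excess x t s e : 0 < e -> tree_dist alpha sigma x t < e ->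
  tree_dist alpha sigma x s < e ->
  Q (tree_inf t s) t < 2 * e ^+ 2 /\ Q (tree_inf t s) s < 2 * e ^+ 2.
Proof.
move=> e0; wlog: t s / tree_le (tree_inf x t) (tree_inf x s).
  move=> H dt ds; have [ts|st] := orP (tree_le_total (tree_inf_lel x t) (tree_inf_lel x s)).
    exact: H.
  by have [] := H _ _ st ds dt; rewrite tree_infC.
move=> u12 /(tree_dist_lt_inf sigma_ge0 e0)[Dx Dt] /(tree_dist_lt_inf sigma_ge0 e0)[Dx' Ds].
set u := tree_inf x t in u12 Dx Dt; set u' := tree_inf x s in u12 Dx' Ds.
set w := tree_inf t s.
have ux : tree_le u x := tree_inf_lel _ _; have ut : tree_le u t := tree_inf_ler _ _.
have u'x : tree_le u' x := tree_inf_lel _ _; have u's : tree_le u' s := tree_inf_ler _ _.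
have uw : tree_le u w by rewrite tree_inf_max// (tree_le_trans u12).
have Qt := (branch_dist_ltP alpha sigma_ge0 e0 ut).1 Dt t ut (tree_le_refl t).
have Qs := (branch_dist_ltP alpha sigma_ge0 e0 u's).1 Ds s u's (tree_le_refl s).
have Qu := (branch_dist_ltP alpha sigma_ge0 e0 ux).1 Dx u' u12 u'x.
have := exprn_gt0 2 e0.
have := le_excess alpha sigma t uw; have := le_excess alpha sigma s uw.
have := excess_trans alpha sigma_ge0 sigma_nincr u12 u's.
by move=> *; split; lra.
Qed.

Lemma ball_cover_sum_dist e c M : 0 < e -> 0 <= M ->
  (forall t, sigma t * Num.sqrt (A t) <= M) ->
  ball_cover (tree_dist alpha sigma) e c ->
  exists2 c', ball_cover (sum_dist alpha sigma) (4 * e) c' &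
    size c' = (size c * (Num.truncn (M / e)).+1)%N.
Proof.
move=> e0 M0 bM cov.
pose a t := sigma t * Num.sqrt (A t); pose l t := Num.truncn (a t / e).
have a0 t : 0 <= a t by rewrite mulr_ge0 ?sqrtr_ge0.
pose f x j := xget root [set t | tree_dist alpha sigma x t < e /\ l t = j].
exists [seq f x j | x <- c, j <- iota 0 (Num.truncn (M / e)).+1]; last first.
  by rewrite size_allpairs size_iota.
move=> s; have [x xc xs] := cov s.
exists (f x (l s)).
  apply: allpairs_f => //; rewrite mem_iota/= add0n ltnS.
  by apply: le_truncn; rewrite ler_wpM2r ?invr_ge0 ?(ltW e0)//; exact: bM.
have [xf fs] : tree_dist alpha sigma x (f x (l s)) < e /\ l (f x (l s)) = l s.
  by rewrite /f; case: xgetP => [_ -> //|/(_ s)]; elim.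
move: (f x (l s)) xf fs => {f} t xt lts.
have [Qt Qs] := ball_excess e0 xt xs.
have e40 : 0 < 4 * e by lra.
rewrite sum_dist_lt//; set w := tree_inf t s in Qt Qs *.
have wt : tree_le w t := tree_inf_lel _ _; have ws : tree_le w s := tree_inf_ler _ _.
have ats : `|a t - a s| <= e.
  have := truncn_itv (divr_ge0 (a0 t) (ltW e0)).
  have := truncn_itv (divr_ge0 (a0 s) (ltW e0)).
  rewrite -/(l t) -/(l s) lts -natr1 !ler_pdivlMr// !ltr_pdivrMr//.
  by rewrite mulrDl mul1r ler_norml => *; lra.
have B0 := branch_weight_ge0 alpha w.
have key r : tree_le w r -> Q w r < 2 * e ^+ 2 ->
    0 <= a r - sigma r * Num.sqrt (A w) <= 2 * e.
  move=> wr Qr; apply/andP; split.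
    by rewrite subr_ge0 ler_wpM2l// ler_wsqrtr// le_branch_weight.
  have := sqrt_branch_weightB wr; rewrite -/(a r).
  have : Num.sqrt (Q w r) <= 2 * e.
    have e2 : 0 <= 2 * e by lra.
    rewrite -(ger0_norm e2) -sqrtr_sqr ler_wsqrtr//; nra.
  lra.
have /andP[t1 t2] := key _ wt Qt; have /andP[s1 s2] := key _ ws Qs.
have : `|(sigma t - sigma s) * Num.sqrt (A w)| <= 3 * e.
  by move: ats; rewrite mulrBl !ler_norml => *; lra.
rewrite -(@ler_pXn2r _ 2) ?nnegrE ?normr_ge0//; last lra.
rewrite real_normK ?num_real// exprMn sqr_sqrtr//; nra.
Qed.

End covers.

Section covering.
Context {R : realType} {T : choiceType} (rho : T -> T -> R).

Lemma covering_number_attained e : covering_number rho e = +oo%E \/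
  exists2 c, ball_cover rho e c & covering_number rho e = (size c)%:R%:E.
Proof.
have [[c0 c0P]|nc] := pselect (exists c, ball_cover rho e c); last first.
  left; rewrite /covering_number (_ : [set _ | _ in _] = set0) ?ereal_inf0//.
  by apply/seteqP; split => // x [c cP]; exfalso; apply: nc; exists c.
right; have : exists n, `[< exists2 c, ball_cover rho e c & size c = n >].
  by exists (size c0); apply/asboolP; exists c0.
move=> /ex_minnP[n /asboolP[c cP cn] nmin]; exists c => //.
apply/eqP; rewrite eq_le; apply/andP; split; first by apply: ereal_inf_lbound; exists c.
apply: le_ereal_inf_tmp => _ [c' c'P <-]; rewrite lee_fin ler_nat cn.
by apply: nmin; apply/asboolP; exists c'.
Qed.

Lemma covering_number_le e c : ball_cover rho e c ->
  (covering_number rho e <= (size c)%:R%:E)%E.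
Proof. by move=> cP; apply: ereal_inf_lbound; exists c. Qed.

Lemma covering_number_ge1 (t : T) e : (1 <= covering_number rho e)%E.
Proof.
apply: le_ereal_inf_tmp => _ [c cP <-]; rewrite lee_fin ler1n.
by have [s + _] := cP t; case: c {cP}.
Qed.

Lemma covering_number_nincr e e' : e <= e' ->
  (covering_number rho e' <= covering_number rho e)%E.
Proof.
move=> ee'; apply: le_ereal_inf_tmp => _ [c cP <-]; apply: covering_number_le => t.
by have [s sc st] := cP t; exists s => //; exact: lt_le_trans ee'.
Qed.

Definition sqrt_entropy e : \bar R := sqrte (lne (covering_number rho e)).

Lemma le_sqrt_entropy (t : T) e e' : e <= e' -> (sqrt_entropy e' <= sqrt_entropy e)%E.
Proof.
move=> ee'; have c1 := covering_number_ge1 t; rewrite /sqrt_entropy.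
have c0 x : covering_number rho x \in `[0, +oo]%E.
  by rewrite in_itv/= leey andbT (le_trans _ (c1 x)).
by rewrite lee_sqrt ?lne_ge0// lee_lne// covering_number_nincr.
Qed.

End covering.

Section measure.
Context {R : realType}.
Local Notation mu := (@lebesgue_measure R).

Lemma nonincreasing_emeasurable (D : set R) (f : R -> \bar R) : measurable D ->
  (forall x y, x <= y -> (f y <= f x)%E) -> measurable_fun D f.
Proof.
move=> mD fni; apply: (measurability (@ErealGenCInfty.G R)) => [|/= _ [_] [r] -> <-].
  exact: ErealGenCInfty.measurableE.
apply: measurableI => //; apply: is_interval_measurable => s t/=.
rewrite !in_itv/= !andbT => fs ft u /andP[su ut].
by rewrite in_itv/= andbT (le_trans ft)// fni.
Qed.

Lemma lebesgue_measure_scale (k : R) (A : set R) : 0 < k -> measurable A ->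
  (k%:E * mu ( *%R k @^-1` A) = mu A)%E.
Proof.
move=> k0 mA; have mk : measurable_fun [set: measurableTypeR R]
    ( *%R k : measurableTypeR R -> measurableTypeR R) by exact: measurable_funM.
pose f : measurableTypeR R -> measurableTypeR R := *%R k.
pose nu := mscale (NngNum (ltW k0)) (pushforward mu f).
rewrite -[LHS]/(nu mk A); apply/esym/lebesgue_measure_unique => //= _ [[a b]] _ <-.
rewrite /nu /mscale/= /pushforward.
rewrite (_ : f @^-1` _ = `]k^-1 * a, k^-1 * b]%classic); last first.
  by apply/seteqP; split => x /=; rewrite !in_itv/= ltr_pdivrMl// ler_pdivlMl.
rewrite !lebesgue_measure_itv/= !lte_fin ltr_pM2l ?invr_gt0//.
by case: ifPn => _; rewrite ?mule0// -!EFinD -EFinM -mulrBr mulrA divff ?mul1r// gt_eqF.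
Qed.

Lemma ge0_integral_scale (k : R) (f : R -> \bar R) : 0 < k ->
  measurable_fun (`]0, +oo[%classic : set R) f -> (forall x, 0 <= f x)%E ->
  (\int[mu]_(x in `]0%R, +oo[) f x = k%:E * \int[mu]_(x in `]0%R, +oo[) f (k * x)%R)%E.
Proof.
move=> k0 mf f0; have mk : measurable_fun [set: measurableTypeR R]
    ( *%R k : measurableTypeR R -> measurableTypeR R) by exact: measurable_funM.
pose h : measurableTypeR R -> measurableTypeR R := *%R k.
have E : h @^-1` `]0, +oo[ = `]0%R, +oo[%classic :> set R.
  by apply/seteqP; split => x /=; rewrite !in_itv/= !andbT pmulr_rgt0.
rewrite -[in RHS]E -(ge0_integral_pushforward (phi := h) mk) => //.
pose nu := mscale (NngNum (ltW k0)) (pushforward mu h).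
transitivity (\int[nu mk]_(x in `]0%R, +oo[) f x)%E.
  by apply: eq_measure_integral => A mA _; exact/esym/lebesgue_measure_scale.
by rewrite ge0_integral_mscale.
Qed.

End measure.

Section transfer.
Context {R : realType}.
Local Notation mu := (@lebesgue_measure R).

Lemma sqrte_leD (x y : \bar R) : (0 <= x)%E -> (0 <= y)%E ->
  (sqrte (x + y) <= sqrte x + sqrte y)%E.
Proof.
case: x => [x| |]//; case: y => [y| |]//; rewrite ?leey// !lee_fin => x0 y0.
rewrite -(@ler_pXn2r _ 2) ?nnegrE ?addr_ge0 ?sqrtr_ge0//.
rewrite sqrrD !sqr_sqrtr// ?addr_ge0//.
by have := mulr_ge0 (sqrtr_ge0 x) (sqrtr_ge0 y); lra.
Qed.

Local Notation dyadic M k := (\1_(`]0, M *+ 2 / (2 ^ k.+1)%:R]%classic) : R -> R).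

(* The [k]-th term is 1 exactly when [2 ^ k <= M / e], so the series is about
   [log2 (M / e)]; it integrates to [2 * M]. *)
Lemma sqrt_ln_truncn_le (M e : R) : 0 < e -> 0 <= M ->
  ((Num.sqrt (ln (Num.truncn (M / e)).+1%:R))%:E <=
   \sum_(k <oo) (dyadic M k e)%:E)%E.
Proof.
move=> e0 M0; set n := Num.truncn _.
have /ex_minnP[p np pmin] : exists p, (n.+1 <= 2 ^ p)%N by exists n.+1; exact: ltnW (ltn_expl _ _).
apply: (@le_trans _ _ (p%:R)%:E).
  have ln2 : ln 2 <= 1 :> R.
    by rewrite (_ : 2 = 1 + 1 :> R)// le_ln1Dx//; lra.
  have lnp : ln (n.+1%:R) <= p%:R ^+ 2 :> R.
    apply: (@le_trans _ _ (ln (2 ^+ p))).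
      by rewrite ler_ln ?posrE// -natrX ler_nat.
    rewrite lnXn// -[ln 2 *+ p]mulr_natl.
    have : p%:R <= p%:R ^+ 2 :> R by rewrite -natrX ler_nat; case: (p) => // q; exact: leq_pmulr.
    have := ler0n R p; nra.
  rewrite lee_fin -[leRHS]ger0_norm// -sqrtr_sqr ler_wsqrtr//.
apply: (@le_trans _ _ (\sum_(0 <= k < p) (dyadic M k e)%:E)%E); last first.
  by apply: nneseries_lim_ge => k _; rewrite lee_fin.
rewrite sumEFin lee_fin big_nat_cond.
rewrite (eq_bigr (fun=> 1)) => [|k /andP[/andP[_ kp] _]].
  by rewrite -big_nat_cond sumr_const_nat subn0.
have k2 : (2 ^ k)%:R <= M / e.
  have /andP[+ _] := truncn_itv (divr_ge0 M0 (ltW e0)); apply: le_trans.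
  by rewrite ler_nat -/n -ltnS ltnNge; apply: contraL kp => /pmin; rewrite -leqNgt.
rewrite indicE mem_set//= in_itv/= e0/= ler_pdivlMr ?ltr0n ?expn_gt0// expnS natrM.
by move: k2; rewrite ler_pdivlMr// -mulr_natr => *; lra.
Qed.

Context {T : choiceType} (t0 : T) (rho1 rho2 : T -> T -> R).
Variables (K M : R).
Hypotheses (K0 : 0 < K) (M0 : 0 <= M).
Hypothesis cover : forall e c, 0 < e -> ball_cover rho2 e c ->
  exists2 c', ball_cover rho1 (K * e) c' &
    (size c' <= size c * (Num.truncn (M / e)).+1)%N.

Lemma lne_covering_number_le e : 0 < e ->
  (lne (covering_number rho1 (K * e)) <=
   lne (covering_number rho2 e) + (ln (Num.truncn (M / e)).+1%:R)%:E)%E.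
Proof.
move=> e0; have [->|[c cP cE]] := covering_number_attained rho2 e.
  by rewrite addye// leey.
have [c' c'P c'c] := cover e0 cP; have := covering_number_ge1 rho2 t0 e.
rewrite cE lee_fin => c1; have c0 := lt_le_trans ltr01 c1.
rewrite lne_EFin// -EFinD -lnM ?posrE// -lne_EFin ?mulr_gt0//.
rewrite lee_lne ?in_itv/= ?leey ?andbT.
- by rewrite (le_trans (covering_number_le c'P))// lee_fin -natrM ler_nat.
- by rewrite (le_trans _ (covering_number_ge1 rho1 t0 _)).
- by rewrite lee_fin mulr_ge0// ltW.
Qed.

Lemma entropy_integral_transfer : (entropy_integral rho2 < +oo)%E ->
  (entropy_integral rho1 < +oo)%E.
Proof.
rewrite /entropy_integral => fin2.
have m1 (D : set R) : measurable D -> measurable_fun D (sqrt_entropy rho1).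
  by move=> mD; apply: nonincreasing_emeasurable => // x y; exact: le_sqrt_entropy t0 _ _.
have m2 (D : set R) : measurable D -> measurable_fun D (sqrt_entropy rho2).
  by move=> mD; apply: nonincreasing_emeasurable => // x y; exact: le_sqrt_entropy t0 _ _.
rewrite [X in (X < _)%E](_ : _ = \int[mu]_(x in `]0%R, +oo[) sqrt_entropy rho1 x)%E//.
rewrite (ge0_integral_scale K0) => [|//|x]; first last.
- exact: sqrte_ge0.
- exact: m1.
rewrite lte_mul_pinfty// ?lee_fin ?ltW//.
pose g k x : \bar R := (dyadic M k x)%:E.
have mg k (D : set R) : measurable D -> measurable_fun D (g k).
  by move=> mD; apply/measurable_EFinP; exact: measurable_indic.
have g0 k x : (0 <= g k x)%E by rewrite lee_fin.
have mgs (D : set R) : measurable D -> measurable_fun D (fun x => \sum_(k <oo) g k x)%E.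
  by move=> mD; apply: ge0_emeasurable_sum => // k _; exact: mg.
apply: (@le_lt_trans _ _ (\int[mu]_(x in `]0%R, +oo[)
   (sqrt_entropy rho2 x + \sum_(k <oo) g k x))%E).
  apply: ge0_le_integral => //.
  - by move=> x _; exact: sqrte_ge0.
  - apply: nonincreasing_emeasurable => // x y xy.
    by apply: (le_sqrt_entropy rho1 t0); rewrite ler_wpM2l// ltW.
  - by apply: emeasurable_funD; [exact: m2|exact: mgs].
  - move=> x /=; rewrite in_itv/= andbT => x0.
    apply: (@le_trans _ _ (sqrte (lne (covering_number rho2 x) +
        (ln (Num.truncn (M / x)).+1%:R)%:E))).
      rewrite lee_sqrt; first exact: lne_covering_number_le.
      by rewrite adde_ge0// ?lne_ge0 ?covering_number_ge1// lee_fin ln_ge0// ler1n.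
    apply: le_trans (sqrte_leD _ _) _.
    + by rewrite lne_ge0 covering_number_ge1.
    + by rewrite lee_fin ln_ge0// ler1n.
    by rewrite leeD2l//; exact: sqrt_ln_truncn_le.
rewrite ge0_integralD//; first last.
- exact: mgs.
- by move=> x _; exact: nneseries_ge0.
- exact: m2.
- by move=> x _; exact: sqrte_ge0.
rewrite lte_add_pinfty// integral_nneseries//; last by move=> k; exact: mg.
apply: (@le_lt_trans _ _ (\sum_(k <oo) (M *+ 2 / (2 ^ k.+1)%:R)%:E)%E).
  apply: lee_nneseries => [k _ _|k _]; first by apply: integral_ge0 => x _; exact: g0.
  rewrite integral_indic//.
  apply: (@le_trans _ _ (mu `]0, M *+ 2 / (2 ^ k.+1)%:R]%classic)).
    by apply: le_measure; rewrite ?inE//; exact: measurableI.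
  rewrite lebesgue_measure_itv/= lte_fin; case: ifPn => _; first by rewrite oppr0 adde0.
  by rewrite lee_fin divr_ge0// mulrn_wge0.
by apply: le_lt_trans (epsilon_trick0 _ _) _; rewrite ?mulrn_wge0 ?ltry.
Qed.

Lemma entropy_sup_transfer : (entropy_sup rho2 < +oo)%E ->
  (entropy_sup rho1 < +oo)%E.
Proof.
set S := entropy_sup rho2 => fin2.
apply: (@le_lt_trans _ _ ((K ^+ 2)%:E * (S + (M ^+ 2)%:E))%E).
  apply: ge_ereal_sup => _ [e + <-]; rewrite /= in_itv/= andbT => e0.
  have e0' : 0 < e / K by rewrite divr_gt0.
  rewrite (_ : e = K * (e / K)); last by rewrite mulrC divfK// gt_eqF.
  move: (e / K) e0' => {e0} {}e e0.
  rewrite exprMn EFinM -muleA lee_pmul2l ?lte_fin ?exprn_gt0//.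
  apply: (@le_trans _ _ ((e ^+ 2)%:E * (lne (covering_number rho2 e) +
      (ln (Num.truncn (M / e)).+1%:R)%:E))%E).
    by rewrite lee_pmul2l ?lte_fin ?exprn_gt0//; exact: lne_covering_number_le.
  rewrite ge0_muleDr ?lne_ge0 ?covering_number_ge1// ?lee_fin ?ln_ge0 ?ler1n//.
  rewrite leeD//.
    by apply: ereal_sup_ubound; exists e => //=; rewrite in_itv/= e0.
  rewrite -EFinM lee_fin.
  have [Me|eM] := ltP M e.
    rewrite (_ : Num.truncn _ = 0%N) ?ln1 ?mulr0 ?sqr_ge0//.
    have /andP[+ _] := truncn_itv (divr_ge0 M0 (ltW e0)).
    rewrite ler_pdivlMr//; case: (Num.truncn _) => // n.
    by rewrite -natr1 mulrDl mul1r => h; exfalso; have := mulr_ge0 (ler0n R n) (ltW e0); lra.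
  have : ln (Num.truncn (M / e)).+1%:R <= M / e.
    rewrite -natr1 addrC; apply: le_trans (le_ln1Dx _) _.
      by rewrite (lt_le_trans (ltrN10 _)).
    by have /andP[] := truncn_itv (divr_ge0 M0 (ltW e0)).
  have : 0 <= ln (Num.truncn (M / e)).+1%:R :> R by rewrite ln_ge0// ler1n.
  by rewrite ler_pdivlMr// => *; nra.
by rewrite lte_mul_pinfty ?lee_fin ?sqr_ge0 ?lte_add_pinfty ?ltry.
Qed.

End transfer.

Section finite_cover.
Context {R : realType} {T : choiceType} (rho : T -> T -> R).

Lemma no_ball_cover_covering_number e :
  ~ (exists2 e, 0 < e & exists c, ball_cover rho e c) -> 0 < e ->
  covering_number rho e = +oo%E.
Proof.
move=> H e0; have [//|[c cP _]] := covering_number_attained rho e.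
by exfalso; apply: H; exists e => //; exists c.
Qed.

Lemma entropy_integral_ball_cover : (entropy_integral rho < +oo)%E ->
  exists2 e, 0 < e & exists c, ball_cover rho e c.
Proof.
move=> fin; apply/not_notP => /no_ball_cover_covering_number H.
move: fin; rewrite /entropy_integral (eq_integral (cst +oo%E)); last first.
  by move=> x; rewrite inE/= in_itv/= andbT => /H ->.
by rewrite integral_cst//= lebesgue_measure_itv/= ltry mulyy.
Qed.

Lemma entropy_sup_ball_cover : (entropy_sup rho < +oo)%E ->
  exists2 e, 0 < e & exists c, ball_cover rho e c.
Proof.
move=> fin; apply/not_notP => /no_ball_cover_covering_number H.
move: fin; rewrite ltNge => /negP; apply; apply: ereal_sup_ubound.
exists 1 => /=; first by rewrite in_itv/= ltr01.
by rewrite H// expr1n mul1e.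
Qed.

End finite_cover.

Section standard_normal.
Context {R : realType}.
Local Notation mu := (@lebesgue_measure R).
Local Notation phi := (normal_pdf (0 : R) 1).
Local Notation N01 := (normal_prob (0 : R) 1).

Lemma ge0_integral_normal_prob (f : R -> \bar R) : (forall x, 0 <= f x)%E ->
  measurable_fun [set: R] f ->
  (\int[N01]_x f x = \int[mu]_x (f x * (phi x)%:E))%E.
Proof.
move=> f0 mf; have dom : N01 `<< mu by exact: normal_prob_dominates.
rewrite -(Radon_Nikodym_SigmaFinite.change_of_variables dom)//.
have mphi : measurable_fun [set: R] (EFin \o phi).
  by apply/measurable_EFinP; exact: measurable_normal_pdf.
have intf := Radon_Nikodym_SigmaFinite.f_integrable dom.
have mRN := measurable_int _ intf.
apply: ge0_ae_eq_integral => //=.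
- exact: emeasurable_funM.
- exact: emeasurable_funM.
- by move=> x _; rewrite mule_ge0// Radon_Nikodym_SigmaFinite.f_ge0.
- by move=> x _; rewrite mule_ge0// lee_fin normal_pdf_ge0.
apply: ae_eqe_mul2l; apply: integral_ae_eq => // E _ mE.
by rewrite -Radon_Nikodym_SigmaFinite.f_integral.
Qed.

Lemma normal_pdfN x : phi (- x) = phi x.
Proof.
by rewrite normal_pdfE ?oner_neq0// /normal_fun !subr0 sqrrN.
Qed.

Lemma normal_prob_opp (A : set R) : measurable A -> N01 (-%R @^-1` A) = N01 A.
Proof.
move=> mA; rewrite /normal_prob.
pose h : measurableTypeR R -> measurableTypeR R := -%R.
have mh : measurable_fun [set: measurableTypeR R] h by exact: oppr_measurable.
rewrite -[X in integral _ X]/(h @^-1` A).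
under eq_integral do rewrite -normal_pdfN.
rewrite -(ge0_integral_pushforward (phi := h) mh mu (f := fun x => (phi x)%:E))//.
- by apply: eq_measure_integral => B mB _; exact: lebesgue_measureN.
- by apply/measurable_EFinP/measurable_funTS; exact: measurable_normal_pdf.
- by move=> x _; rewrite lee_fin normal_pdf_ge0.
Qed.

Lemma standard_normal_pdfE x : phi x = normal_peak 1 * expR (- (x ^+ 2 / 2)).
Proof.
by rewrite normal_pdfE ?oner_neq0// /normal_fun subr0 expr1n mulNr.
Qed.

Lemma is_derive_mul_normal_pdf (x : R) :
  is_derive x 1 (fun y => - (y * phi y)) ((x ^+ 2 - 1) * phi x).
Proof.
have dg : is_derive x 1 (fun y : R => - (y ^+ 2 / 2)) (- x).
  by apply: is_derive_eq; rewrite /GRing.scale/=; field.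
have de : is_derive x 1 (expR \o (fun y : R => - (y ^+ 2 / 2))) (expR (- (x ^+ 2 / 2)) * (- x)).
  exact: is_derive1_comp.
have dphi : is_derive x 1 phi (- x * phi x).
  have E : phi = normal_peak 1 \*: (expR \o (fun y : R => - (y ^+ 2 / 2))).
    by apply/funext => y; rewrite standard_normal_pdfE.
  rewrite [X in is_derive _ _ X _]E.
  by apply: is_derive_eq; rewrite standard_normal_pdfE /GRing.scale/=; ring.
by apply: is_derive_eq; rewrite /GRing.scale/=; ring.
Qed.

Lemma cvg_mul_normal_pdf : x * phi x @[x --> +oo] --> (0 : R).
Proof.
have c0 := @normal_peak_ge0 R 1.
apply: (@squeeze_cvgr _ _ _ _ (cst 0) (fun x => normal_peak 1 * 2 * x^-1)).
- near=> x; have x0 : 0 < x by near: x; exact: nbhs_pinfty_gt.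
  rewrite standard_normal_pdfE /= mulrCA -mulrA; apply/andP; split.
    by rewrite !mulr_ge0 ?expR_ge0// ltW.
  rewrite ler_wpM2l// expRN ler_pdivrMr ?expR_gt0//.
  have := expR_ge1Dx (x ^+ 2 / 2); set E := expR _ => E1.
  rewrite mulrAC ler_pdivlMr//; nra.
- exact: cvg_cst.
- rewrite -[X in _ --> X](mulr0 (normal_peak 1 * 2)); apply: cvgMr.
  by apply/gtr0_cvgV0; [exact: nbhs_pinfty_gt|exact: cvg_id].
Unshelve. all: by end_near. Qed.

Lemma continuous_sqr_normal_pdf (a b : R) : continuous (fun x : R => (a * x ^+ 2 + b) * phi x).
Proof.
move=> x; apply: cvgM; last by apply: continuous_normal_pdf; exact: oner_neq0.
by apply: cvgD; [apply: cvgMr; exact: sqr_continuous|exact: cvg_cst].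
Qed.

Lemma continuous_mul_normal_pdf : continuous (fun x : R => x * phi x).
Proof.
move=> x; apply: cvgM; first exact: cvg_id.
by apply: continuous_normal_pdf; exact: oner_neq0.
Qed.

Lemma integral_sqr_normal_pdf_gt1 :
  (\int[mu]_(x in `[1%R, +oo[) ((x ^+ 2 - 1) * phi x)%:E = (phi 1)%:E)%E.
Proof.
rewrite (@ge0_continuous_FTC2y _ _ (fun y => - (y * phi y)) _ 0).
- by rewrite sub0e mul1r EFinN oppeK.
- move=> x x1; rewrite mulr_ge0 ?normal_pdf_ge0// subr_ge0.
  by rewrite expr_ge1// (le_trans ler01).
- apply: continuous_subspaceT.
  by have := @continuous_sqr_normal_pdf 1 (-1); under eq_fun do rewrite mul1r.
- by rewrite -[X in _ --> X]oppr0; apply: cvgN; exact: cvg_mul_normal_pdf.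
- by move=> x _; have [] := is_derive_mul_normal_pdf x.
- by apply: cvg_at_right_filter; apply: cvgN; exact: continuous_mul_normal_pdf.
- by move=> x _; rewrite derive1E; have [] := is_derive_mul_normal_pdf x.
Qed.

Lemma integral_sqr_normal_pdf_lt1 :
  (\int[mu]_(x in `[0%R, 1%R]) ((1 - x ^+ 2) * phi x)%:E = (phi 1)%:E)%E.
Proof.
have D (x : R) : is_derive x 1 (fun y : R => y * phi y) ((1 - x ^+ 2) * phi x).
  have := is_deriveN (is_derive_mul_normal_pdf x).
  rewrite (_ : - _ = (fun y : R => y * phi y)); last first.
    by apply/funext => y; rewrite /= opprK.
  by rewrite -mulNr opprB.
rewrite (@continuous_FTC2 _ _ (fun y => y * phi y)) ?ltr01//.
- by rewrite mul0r mul1r sube0.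
- apply: continuous_subspaceT.
  have := @continuous_sqr_normal_pdf (-1) 1; under eq_fun do rewrite mulN1r addrC.
  by [].
- split.
  + by move=> x _; have [] := D x.
  + by apply: cvg_at_right_filter; exact: continuous_mul_normal_pdf.
  + by apply: cvg_at_left_filter; exact: continuous_mul_normal_pdf.
- by move=> x _; rewrite derive1E; have [] := D x.
Qed.

Lemma normal_second_moment : (\int[N01]_x (x ^+ 2)%:E = 1)%E.
Proof.
rewrite ge0_integral_normal_prob; last 2 first.
- by move=> x; rewrite lee_fin sqr_ge0.
- by apply/measurable_EFinP; exact: measurable_funX.
under eq_integral do rewrite -EFinM.
have p0 x : 0 <= phi x := normal_pdf_ge0 0 1 x.
have f0 x : 0 <= x ^+ 2 * phi x by rewrite mulr_ge0 ?sqr_ge0.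
have cphi : continuous phi by apply: continuous_normal_pdf; exact: oner_neq0.
have cf : continuous (fun x : R => x ^+ 2 * phi x).
  by have := @continuous_sqr_normal_pdf 1 0; under eq_fun do rewrite addr0 mul1r.
have m (h : R -> R) (D : set R) : continuous h -> measurable_fun D (EFin \o h).
  move=> ch; apply/measurable_EFinP/measurable_funTS.
  exact: continuous_measurable_fun.
rewrite -[RHS](integral_normal_pdf 0 (1 : R)).
rewrite (ge0_symfun_integralT f0 cf); last by move=> x /=; rewrite sqrrN normal_pdfN.
rewrite (ge0_symfun_integralT p0 cphi); last by move=> x /=; rewrite normal_pdfN.
congr (_ * _)%E; rewrite -set_itvcy.
have split01 (h : R -> R) : (forall x, 0 <= h x) -> continuous h ->
    (\int[mu]_(x in `[0%R, +oo[) (h x)%:E =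
    \int[mu]_(x in `[0%R, 1%R]) (h x)%:E + \int[mu]_(x in `[1%R, +oo[) (h x)%:E)%E.
  move=> h0 ch; rewrite -[X in (_ = _ + X)%E]integral_itv_obnd_cbnd; last exact: m.
  rewrite -ge0_integral_setU//=.
  - by rewrite -itv_bndbnd_setU//= bnd_simp.
  - exact: m.
  - by move=> x _; rewrite lee_fin.
  - apply/disj_setPS => x []/=; rewrite !in_itv/= andbT => /andP[_].
    by rewrite leNgt => /negP.
rewrite !split01//.
have -> : (\int[mu]_(x in `[1%R, +oo[) (x ^+ 2 * phi x)%:E =
    (phi 1)%:E + \int[mu]_(x in `[1%R, +oo[) (phi x)%:E)%E.
  rewrite -integral_sqr_normal_pdf_gt1 -ge0_integralD//.
  - by apply: eq_integral => x _; rewrite -EFinD; congr _%:E; ring.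
  - move=> x /=; rewrite in_itv/= andbT => x1; rewrite lee_fin mulr_ge0// subr_ge0.
    by rewrite expr_ge1// (le_trans ler01).
  - by apply: m; have := @continuous_sqr_normal_pdf 1 (-1); under eq_fun do rewrite mul1r.
  - by move=> x _; rewrite lee_fin p0.
  - exact: m.
have -> : (\int[mu]_(x in `[0%R, 1%R]) (phi x)%:E =
    (phi 1)%:E + \int[mu]_(x in `[0%R, 1%R]) (x ^+ 2 * phi x)%:E)%E.
  rewrite -integral_sqr_normal_pdf_lt1 -ge0_integralD//.
  - by apply: eq_integral => x _; rewrite -EFinD; congr _%:E; ring.
  - move=> x /=; rewrite in_itv/= => /andP[x0 x1]; rewrite lee_fin mulr_ge0// subr_ge0.
    by rewrite expr_le1.
  - by apply: m; have := @continuous_sqr_normal_pdf (-1) 1; under eq_fun do rewrite mulN1r addrC.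
  - by move=> x _; rewrite lee_fin f0.
  - exact: m.
by rewrite addeCA addeA.
Qed.

End standard_normal.

Section gaussian.
Context {d : measure_display} {Omega : measurableType d} {R : realType}
  (P : probability Omega R).
Local Notation N01 := (normal_prob (0 : R) 1).
Implicit Types X Y : {RV P >-> R}.

Lemma measurable_RV X : measurable_fun [set: Omega] (X : Omega -> measurableTypeR R).
Proof. by move=> _ A mA; exact: measurable_funPT. Qed.

Lemma standard_normal_sqr X : standard_normal X ->
  (\int[P]_w (X w ^+ 2)%:E = 1)%E.
Proof.
move=> nX; rewrite -normal_second_moment.
pose X' : Omega -> measurableTypeR R := X.
have mX : measurable_fun [set: Omega] X' by exact: measurable_RV.
rewrite -[LHS]/(\int[P]_(w in X' @^-1` setT) ((fun x => (x ^+ 2)%:E) \o X') w)%E.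
rewrite -(ge0_integral_pushforward mX)//.
- by apply: eq_measure_integral => A mA _; exact: nX.
- by apply/measurable_EFinP; exact: measurable_funX.
- by move=> x _; rewrite lee_fin sqr_ge0.
Qed.

Lemma integrable_sqr X : standard_normal X ->
  P.-integrable [set: Omega] (fun w => (X w ^+ 2)%:E).
Proof.
move=> nX; apply/integrableP; split.
  by apply/measurable_EFinP; exact: measurable_funX.
under eq_integral do rewrite gee0_abs ?lee_fin ?sqr_ge0//.
by rewrite standard_normal_sqr// ltry.
Qed.

Lemma integrable_mul X Y : standard_normal X -> standard_normal Y ->
  P.-integrable [set: Omega] (fun w => (X w * Y w)%:E).
Proof.
move=> nX nY.
apply: (@le_integrable _ _ _ _ _ _ _ (fun w => (X w ^+ 2)%:E + (Y w ^+ 2)%:E)%E) => //.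
- by apply/measurable_EFinP; exact: measurable_funM.
- move=> w _; rewrite -EFinD !abse_EFin lee_fin normrM [leRHS]ger0_norm ?addr_ge0 ?sqr_ge0//.
  rewrite -(real_normK (num_real (X w))) -(real_normK (num_real (Y w))).
  have := sqr_ge0 (`|X w| - `|Y w|); have := sqr_ge0 (`|X w| + `|Y w|); nra.
- by apply: integrableD => //; exact: integrable_sqr.
Qed.

(* The product rule determines the joint law, and it also holds for the pair
   [(- X, Y)] by symmetry; hence [E (X Y) = E (- X Y)]. *)
Lemma indep_normal_uncorrelated X Y : standard_normal X -> standard_normal Y ->
  (forall A B : set R, measurable A -> measurable B ->
    P (X @^-1` A `&` Y @^-1` B) = P (X @^-1` A) * P (Y @^-1` B))%E ->
  (\int[P]_w (X w * Y w)%:E = 0)%E.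
Proof.
move=> nX nY iXY.
pose f w : measurableTypeR R * measurableTypeR R := (X w, Y w).
pose g w : measurableTypeR R * measurableTypeR R := (- X w, Y w).
have mf : measurable_fun [set: Omega] f.
  by apply: measurable_fun_pair; exact: measurable_RV.
have mg : measurable_fun [set: Omega] g.
  apply: measurable_fun_pair; last exact: measurable_RV.
  by apply: measurableT_comp; [exact: oppr_measurable|exact: measurable_RV].
have pf A B : measurable A -> measurable B ->
    (pushforward P f (A `*` B) = N01 A * N01 B)%E.
  move=> mA mB; rewrite -nX// -nY// -iXY//.
have pg A B : measurable A -> measurable B ->
    (pushforward P g (A `*` B) = N01 A * N01 B)%E.
  move=> mA mB; rewrite -(normal_prob_opp mA) -nX; last first.
    by rewrite -[X in measurable X]setTI; exact: oppr_measurable.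
  rewrite -nY// -iXY//; rewrite -[X in measurable X]setTI; exact: oppr_measurable.
have law C : measurable C -> pushforward P f C = pushforward P g C.
  have Uf := @product_measure_unique _ _ _ _ _ N01 N01 (pushforward P f).
  have Ug := @product_measure_unique _ _ _ _ _ N01 N01 (pushforward P g).
  by move=> mC; rewrite -(Uf mf pf C mC) (Ug mg pg C mC).
have iM := integrable_mul nX nY.
pose p (x : measurableTypeR R * measurableTypeR R) : \bar R := (x.1 * x.2)%:E.
have mp : measurable_fun setT p.
  by apply/measurable_EFinP; apply: measurable_funM.
have I : (\int[P]_w (X w * Y w)%:E = \int[P]_w (- (X w * Y w))%:E)%E.
  transitivity (\int[pushforward P f]_x p x)%E.
    by rewrite integral_pushforward.
  transitivity (\int[pushforward P g]_x p x)%E.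
    by apply: eq_measure_integral => C mC _; exact: law.
  rewrite integral_pushforward//.
    by apply: eq_integral => w _; rewrite /p/= mulNr.
  rewrite preimage_setT (_ : p \o g = -%E \o (fun w => (X w * Y w)%:E)).
    exact: integrableN.
  by apply/funext => w; rewrite /p/= mulNr EFinN.
move: I; under [X in _ = X -> _]eq_integral do rewrite EFinN.
rewrite integralN; last by apply: integrable_add_def.
have : (\int[P]_w (X w * Y w)%:E)%E \is a fin_num by exact: integrable_fin_num.
move=> /fineK <-; rewrite -EFinN => -[] h; congr _%:E; lra.
Qed.

Lemma integral_sqr_sum (I : choiceType) (xi : I -> {RV P >-> R}) (a : I -> R) (s : seq I) :
  mutually_independent xi -> (forall v, standard_normal (xi v)) -> uniq s ->
  (\int[P]_w ((\sum_(v <- s) a v * xi v w) ^+ 2)%:E = (\sum_(v <- s) a v ^+ 2)%:E)%E.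
Proof.
move=> ind nor us.
have cov v w : (\int[P]_x (xi v x * xi w x)%:E)%E = ((v == w)%:R)%:E.
  have [<-|vw] := eqVneq v w.
    by under eq_integral do rewrite -expr2; rewrite standard_normal_sqr.
  apply: indep_normal_uncorrelated => // A B mA mB.
  have := ind [:: v; w] (fun i => if i == v then A else B).
  rewrite /= inE vw => /(_ isT) H.
  have {}H := H (fun i => ltac:(by case: ifP)).
  move: H; rewrite !big_cons big_nil mule1 eqxx eq_sym (negbTE vw) => <-.
  congr (P _); apply/seteqP; split => x /=.
    move=> [xA xB] i; rewrite /= !inE => /orP[]/eqP->.
      by rewrite eqxx.
    by rewrite eq_sym (negbTE vw).
  move=> H; split; first by have := H v; rewrite /= eqxx !inE eqxx; exact.
  by have := H w; rewrite /= eq_sym (negbTE vw) !inE eqxx orbT; exact.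
have iM v w := integrable_mul (nor v) (nor w).
transitivity (\int[P]_x
    \sum_(v <- s) \sum_(w <- s) ((a v * a w)%:E * (xi v x * xi w x)%:E))%E.
  apply: eq_integral => x _; rewrite expr2 big_distrlr/= -sumEFin.
  apply: eq_bigr => v _; rewrite -sumEFin; apply: eq_bigr => w _.
  by rewrite -EFinM; congr _%:E; ring.
have iZ v w : P.-integrable [set: Omega] (fun x => (a v * a w)%:E * (xi v x * xi w x)%:E)%E.
  exact: integrableZl.
rewrite integral_sum// => [|v]; last exact: integrable_sum.
rewrite -sumEFin big_seq [RHS]big_seq; apply: eq_bigr => v vs.
rewrite integral_sum//; under eq_bigr do rewrite integralZl// cov.
rewrite (bigD1_seq v)//= eqxx mule1 big1 ?adde0// => w wv.
by rewrite eq_sym (negbTE wv) mule0.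
Qed.

End gaussian.

Lemma dudley_dist_weighted_sum (R : realType) (T : rootedTree) (alpha sigma : T -> R)
    (d : measure_display) (Omega : measurableType d) (P : probability Omega R)
    (xi : T -> {RV P >-> R}) t s :
  mutually_independent xi -> (forall v, standard_normal (xi v)) ->
  dudley_dist P (weighted_sum alpha sigma xi) t s = sum_dist alpha sigma t s.
Proof.
move=> ind nor; rewrite /dudley_dist /sum_dist; congr Num.sqrt.
set w := tree_inf t s.
have wt : tree_le w t := tree_inf_lel _ _; have ws : tree_le w s := tree_inf_ler _ _.
pose S := branch w ++ [seq v <- branch t | tree_lt w v] ++
  [seq v <- branch s | tree_lt w v].
pose a v := alpha v * (if tree_le v w then sigma t - sigma s
  else if tree_le v t then sigma t else - sigma s).
have nlt v : tree_lt w v -> tree_le v w = false.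
  by move=> wv; apply/negbTE; rewrite -(tree_ltNge (tree_ltW wv) (tree_le_refl v)).
have nts v : tree_lt w v -> tree_le v s -> tree_le v t = false.
  move=> wv vs; apply/negbTE; apply: contraFN (nlt _ wv) => vt.
  exact: tree_inf_max.
have uS : uniq S.
  rewrite !cat_uniq !filter_uniq ?branch_uniq// !andTb !andbT.
  apply/andP; split; apply/hasPn => v; rewrite ?mem_cat !mem_filter.
    by move=> /orP[]/andP[wv _]; rewrite /= -/(tree_le v w) nlt.
  by move=> /andP[wv vs]; rewrite /= -/(tree_le v t) wv (nts _ wv vs).
have sumS (F : T -> R -> R) : \sum_(v <- S) F v (a v) =
    \sum_(v <- branch w) F v (alpha v * (sigma t - sigma s)) +
    (\sum_(v <- branch t | tree_lt w v) F v (alpha v * sigma t) +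
     \sum_(v <- branch s | tree_lt w v) F v (alpha v * - sigma s)).
  rewrite !big_cat !big_filter; congr (_ + (_ + _)).
  - by rewrite big_seq [RHS]big_seq; apply: eq_bigr => v; rewrite /a -/(tree_le v w) => ->.
  - rewrite big_seq_cond [RHS]big_seq_cond; apply: eq_bigr => v /andP[vt wv].
    by rewrite /a nlt// (vt : tree_le v t).
  - rewrite big_seq_cond [RHS]big_seq_cond; apply: eq_bigr => v /andP[vs wv].
    by rewrite /a nlt// nts.
rewrite unlock (eq_integral (fun x => ((\sum_(v <- S) a v * xi v x) ^+ 2)%:E)); last first.
  move=> x _; rewrite real_normK ?num_real//; congr (_ ^+ 2)%:E.
  rewrite /weighted_sum (sum_branch_split _ wt) (sum_branch_split _ ws).
  rewrite (sumS (fun v b => b * xi v x)) !mulrDr !big_distrr/=.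
  rewrite opprD addrACA -sumrB; congr (_ + _).
    by apply: eq_bigr => v _; ring.
  by rewrite -sumrN; congr (_ + _); apply: eq_bigr => v _; ring.
rewrite integral_sqr_sum//= (sumS (fun v b => b ^+ 2)) /excess !branch_weightB//.
rewrite !big_distrr/= addrA; congr (_ + _ + _); apply: eq_bigr => v _; ring.
Qed.

Theorem theorem5p2 (R : realType) (T : rootedTree) (alpha sigma : T -> R)
    (alpha_ge0 : forall t, 0 <= alpha t) (sigma_ge0 : forall t, 0 <= sigma t)
    (sigma_nincr : forall t s, tree_le t s -> sigma s <= sigma t)
    (d : measure_display) (Omega : measurableType d) (P : probability Omega R)
    (xi : T -> {RV P >-> R}) (xi_indep : mutually_independent xi)
    (xi_normal : forall v, standard_normal (xi v)) :
  let d_X := dudley_dist P (weighted_sum alpha sigma xi) in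
  let d_T := tree_dist alpha sigma in
  ((entropy_integral d_X < +oo)%E <-> (entropy_integral d_T < +oo)%E) /\
  ((entropy_sup d_X < +oo)%E <-> (entropy_sup d_T < +oo)%E).
Proof.
move=> d_X d_T.
have -> : d_X = sum_dist alpha sigma.
  by apply/funext => t; apply/funext => s; exact: dudley_dist_weighted_sum.
have coverT e c : 0 < e -> ball_cover (sum_dist alpha sigma) e c ->
    exists2 c', ball_cover d_T (6 * e) c' &
      (size c' <= size c * (Num.truncn (0 / e : R)).+1)%N.
  move=> e0 /(ball_cover_tree_dist sigma_ge0 sigma_nincr e0)[c' c'P cc'].
  by exists c' => //; rewrite cc' leq_pmulr.
have coverX e0 c0 : 0 < e0 -> ball_cover d_T e0 c0 ->
    exists2 M, 0 <= M & forall e c, 0 < e -> ball_cover d_T e c ->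
    exists2 c', ball_cover (sum_dist alpha sigma) (4 * e) c' &
      (size c' <= size c * (Num.truncn (M / e)).+1)%N.
  move=> e00 /(sqrt_branch_weight_bounded sigma_ge0 sigma_nincr e00)[M M0 bM].
  exists M => // e c e1 /(ball_cover_sum_dist sigma_ge0 sigma_nincr e1 M0 bM)[c' c'P cc'].
  by exists c' => //; rewrite cc'.
split; split => fin.
- exact: (entropy_integral_transfer root _ _ coverT).
- have [e e0 [c /(coverX _ _ e0)[M M0 cM]]] := entropy_integral_ball_cover fin.
  exact: (entropy_integral_transfer root _ M0 cM).
- exact: (entropy_sup_transfer root _ _ coverT).
- have [e e0 [c /(coverX _ _ e0)[M M0 cM]]] := entropy_sup_ball_cover fin.
  exact: (entropy_sup_transfer root _ M0 cM).
Qed.
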